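(* Let $X$ be a finite alphabet with $|X|=N$, and let each symbol $x\in X$ act on the state space $\{0,1\}$ by a map $T_x\colon\{0,1\}\to\{0,1\}$ that is either the constant map $1$ (class GEN), the identity (class PROP), or the constant map $0$ (class KILL). Let $g,t,k$ be the numbers of GEN, PROP, KILL symbols ($g+t+k=N$) and put $\mathfrak{d}=gt$. Let $a(L)$ be the number of cascade-free sequences in $X^L$. Then \[a(L)=N\,a(L-1)-\mathfrak{d}\,a(L-2)\quad (L\ge 2),\qquad a(0)=1,\ a(1)=N.\] Case 1: if $N^2>4\mathfrak{d}$, then with $\lambda_{1,2}=\bigl(N\pm\sqrt{N^2-4\mathfrak{d}}\bigr)/2$ we have $a(L)=(\lambda_1^{L+1}-\lambda_2^{L+1})/(\lambda_1-\lambda_2)$. Case 2: $N^2=4\mathfrak{d}$ holds if and only if $k=0$ and $g=t=N/2$; in that case $a(L)=(L+1)(N/2)^L$.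
   Context: For a sequence $x_1,\dots,x_L\in X^L$, its state trajectory is $\sigma_0=0$, $\sigma_j=T_{x_j}(\sigma_{j-1})$ for $1\le j\le L$. The sequence is called cascade-free if there is no position $j$ with $x_j$ a PROP symbol and $\sigma_{j-1}=1$ (i.e. no PROP symbol ever receives state $1$). *)

(* Defs.v *)
From mathcomp Require Import all_boot all_order all_algebra.

Set Implicit Arguments.
Unset Strict Implicit.
Unset Printing Implicit Defensive.

(* The state space {0,1} is [bool], with 1 = [true] and 0 = [false]. *)

Definition is_GEN (f : bool -> bool) : bool := [forall s, f s == true].
Definition is_PROP (f : bool -> bool) : bool := [forall s, f s == s].
Definition is_KILL (f : bool -> bool) : bool := [forall s, f s == false].

Definition num_GEN (X : finType) (T : X -> bool -> bool) : nat :=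
  #|[set x | is_GEN (T x)]|.
Definition num_PROP (X : finType) (T : X -> bool -> bool) : nat :=
  #|[set x | is_PROP (T x)]|.
Definition num_KILL (X : finType) (T : X -> bool -> bool) : nat :=
  #|[set x | is_KILL (T x)]|.

(* sigma_j, the state reached from 0 after reading the first j symbols of w. *)
Definition trajectory (X : Type) (T : X -> bool -> bool) (w : seq X) (j : nat)
    : bool :=
  foldl (fun s x => T x s) false (take j w).

(* Positions are numbered from 0: [tnth w j] is the symbol x_(j+1), and it
   receives the state sigma_j. *)
Definition cascade_free (X : Type) (T : X -> bool -> bool) (L : nat)
    (w : L.-tuple X) : bool :=
  ~~ [exists j : 'I_L, is_PROP (T (tnth w j)) && (trajectory T w j == true)].

Definition num_cascade_free (X : finType) (T : X -> bool -> bool) (L : nat)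
    : nat :=
  #|[set w : L.-tuple X | cascade_free T w]|.

(* Main.v *)
Require Import Defs.
From mathcomp Require Import all_boot all_order all_algebra.
From mathcomp Require Import zify ring.

(** Let [c0 L] and [c1 L] count the cascade-free words of length [L] read from
    state 0 and from state 1.  Conditioning on the first symbol,
    [c0 (L+1) = g c1(L) + (t+k) c0(L)] and [c1 (L+1) = g c1(L) + k c0(L)], so
    [c1 (L+1) = c0 (L+1) - t c0(L)]; eliminating [c1] gives the recurrence.
    For the closed forms, a solution of the recurrence with characteristic
    roots [p, q] satisfies [u (L+1) = p u(L) + q^(L+1)].  The degenerate case
    rests on [(g+t+k)^2 - 4gt = (g-t)^2 + k(2g+2t+k)]. *)

Import Order.TTheory GRing.Theory Num.Theory.
Local Open Scope ring_scope.

(** * Symbol classes read off the two values of a map *)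

Lemma is_GENE (f : bool -> bool) : is_GEN f = f false && f true.
Proof.
apply/forallP/andP => [h|[h0 h1] []]; last 2 first.
- by rewrite h1.
- by rewrite h0.
by split; apply/eqP; apply: h.
Qed.

Lemma is_PROPE (f : bool -> bool) : is_PROP f = ~~ f false && f true.
Proof.
apply/forallP/andP => [h|[h0 h1] []]; last 2 first.
- by rewrite h1.
- by rewrite (negbTE h0).
by rewrite (eqP (h false)) (eqP (h true)).
Qed.

Lemma is_KILLE (f : bool -> bool) : is_KILL f = ~~ f false && ~~ f true.
Proof.
apply/forallP/andP => [h|[h0 h1] []]; last 2 first.
- by rewrite (negbTE h1).
- by rewrite (negbTE h0).
by rewrite (eqP (h false)) (eqP (h true)).
Qed.

Lemma existsb_ord_recl (n : nat) (P : pred 'I_n.+1) :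
  [exists i, P i] = P ord0 || [exists i, P (lift ord0 i)].
Proof.
apply/existsP/orP => [[i]|[P0|/existsP[i Pi]]]; last 2 first.
- by exists ord0.
- by exists (lift ord0 i).
by case: (unliftP ord0 i) => [j|] -> Pi; [right; apply/existsP; exists j|left].
Qed.

(** * Counting cascade-free words by their first symbol *)

Section Counting.

Variables (X : finType) (T : X -> bool -> bool).

(** The start state is a parameter because removing the first symbol [x] leaves a word read from
    [T x s]. *)
Fixpoint cascade_free_from (s : bool) (w : seq X) : bool :=
  if w is x :: w' then
    ~~ (is_PROP (T x) && s) && cascade_free_from (T x s) w'
  else true.

Definition num_cascade_free_from (s : bool) (L : nat) : nat :=
  (\sum_(w : L.-tuple X) cascade_free_from s w)%N.

Lemma cascade_free_fromE (s : bool) (L : nat) (w : L.-tuple X) :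
  cascade_free_from s w =
  ~~ [exists j : 'I_L, is_PROP (T (tnth w j)) &&
        (foldl (fun s x => T x s) s (take j w) == true)].
Proof.
elim: L s w => [|L IHL] s w.
  by rewrite tuple0 /=; symmetry; apply/existsP => -[[]].
case/tupleP: w => x w /=; rewrite IHL existsb_ord_recl /= negb_or.
rewrite (tnth_nth x) /= eqb_id; congr (_ && ~~ _).
by apply: eq_existsb => j; rewrite !(tnth_nth x).
Qed.

Lemma num_cascade_freeE (L : nat) :
  num_cascade_free T L = num_cascade_free_from false L.
Proof.
rewrite /num_cascade_free cardsE -sum1_card big_mkcond.
by apply: eq_bigr => w _; rewrite cascade_free_fromE.
Qed.

Lemma num_cascade_free_from0 (s : bool) : num_cascade_free_from s 0 = 1%N.
Proof.
rewrite /num_cascade_free_from (eq_bigr (fun=> 1%N)); last first.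
  by move=> w _; rewrite tuple0.
by rewrite sum1_card card_tuple.
Qed.

(** Splitting off the head is a bijection from words of length [L.+1] to pairs of a symbol and a
    word of length [L]. *)
Lemma num_cascade_free_fromS (s : bool) (L : nat) :
  num_cascade_free_from s L.+1 =
  (\sum_x ~~ (is_PROP (T x) && s) * num_cascade_free_from (T x s) L)%N.
Proof.
under eq_bigr do rewrite big_distrr /=.
rewrite pair_bigA /= /num_cascade_free_from.
rewrite (reindex (fun p : X * L.-tuple X => cons_tuple p.1 p.2)) /=.
  by apply: eq_bigr => -[x w] _; rewrite mulnb.
exists (fun w => (thead w, behead_tuple w)) => [[x w] _|w _] /=.
  by congr (_, _); apply: val_inj.
by case/tupleP: w => x w; apply: val_inj.
Qed.

Hypothesis hT : forall x : X, [|| is_GEN (T x), is_PROP (T x) | is_KILL (T x)].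

(** The classes are disjoint and, by [hT], exhaustive: negation is the only other map on [bool]. So
    at each [x] exactly one of the three indicators is 1. *)
Lemma sum_by_class (F : X -> nat) (A B C : nat) :
  (forall x, is_GEN (T x) -> F x = A) ->
  (forall x, is_PROP (T x) -> F x = B) ->
  (forall x, is_KILL (T x) -> F x = C) ->
  (\sum_x F x = num_GEN T * A + num_PROP T * B + num_KILL T * C)%N.
Proof.
move=> hA hB hC.
have cardE (P : pred X) : #|[set x | P x]| = (\sum_x P x)%N.
  by rewrite cardsE -sum1_card big_mkcond.
rewrite /num_GEN /num_PROP /num_KILL !cardE !big_distrl -!big_split /=.
apply: eq_bigr => x _.
move: (hT x) (hA x) (hB x) (hC x); rewrite !is_GENE !is_PROPE !is_KILLE.
case: (T x false); case: (T x true) => //= _ eA eB eC;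
  rewrite ?mul0n ?addn0 ?add0n mul1n; [exact: eA | exact: eB | exact: eC].
Qed.

Lemma card_classes : #|X| = (num_GEN T + num_PROP T + num_KILL T)%N.
Proof. by rewrite -sum1_card (sum_by_class _ 1 1 1)// !muln1. Qed.

Lemma num_cascade_free_from_false (L : nat) :
  num_cascade_free_from false L.+1 =
  (num_GEN T * num_cascade_free_from true L
   + num_PROP T * num_cascade_free_from false L
   + num_KILL T * num_cascade_free_from false L)%N.
Proof.
rewrite num_cascade_free_fromS; apply: sum_by_class => x;
  rewrite ?is_GENE ?is_PROPE ?is_KILLE andbF mul1n.
- by case/andP => ->.
- by case/andP => /negbTE ->.
- by case/andP => /negbTE ->.
Qed.

Lemma num_cascade_free_from_true (L : nat) :
  num_cascade_free_from true L.+1 =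
  (num_GEN T * num_cascade_free_from true L
   + num_KILL T * num_cascade_free_from false L)%N.
Proof.
(* A PROP symbol read in state 1 is forbidden, so its class enters with weight 0; the zero term is
   inserted to fit [sum_by_class]. *)
rewrite num_cascade_free_fromS -[X in (X + _)%N]addn0.
rewrite -[X in (_ + X + _)%N](muln0 (num_PROP T)).
apply: sum_by_class => x; rewrite ?is_GENE ?is_PROPE ?is_KILLE andbT.
- by case/andP => -> ->; rewrite mul1n.
- by move=> ->.
- by case/andP => -> /negbTE ->; rewrite mul1n.
Qed.

Lemma num_cascade_freeSS (L : nat) :
  (num_cascade_free T L.+2 + num_GEN T * num_PROP T * num_cascade_free T L =
   #|X| * num_cascade_free T L.+1)%N.
Proof.
rewrite !num_cascade_freeE card_classes.
(* Everything is expanded down to length [L], which leaves a polynomial identity in the class sizes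
   and the two counts at [L]. *)
rewrite (num_cascade_free_from_false L.+1) num_cascade_free_from_true.
rewrite num_cascade_free_from_false; nia.
Qed.

Lemma num_cascade_free0 : num_cascade_free T 0 = 1%N.
Proof. by rewrite num_cascade_freeE num_cascade_free_from0. Qed.

Lemma num_cascade_free1 : num_cascade_free T 1 = #|X|.
Proof.
rewrite num_cascade_freeE num_cascade_free_from_false !num_cascade_free_from0.
by rewrite !muln1 card_classes.
Qed.

End Counting.

(** * Second-order linear recurrences with given characteristic roots *)

Section SecondOrderRecurrence.

Variables (R : comNzRingType) (u : nat -> R) (p q : R).
Hypotheses (u0 : u 0 = 1) (u1 : u 1 = p + q).
Hypothesis uSS : forall L, u L.+2 = (p + q) * u L.+1 - p * q * u L.

(** The recurrence says that [u L.+1 - p * u L] is multiplied by [q] at each step, and it starts at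
    [q]. *)
Lemma recurrence_first_order (L : nat) : u L.+1 = p * u L + q ^+ L.+1.
Proof.
elim: L => [|L IHL]; first by rewrite u1 u0 mulr1 expr1.
by rewrite uSS exprS; move: IHL => /(canLR (addKr _)) <-; ring.
Qed.

(** Keeping [p - q] as a factor avoids division, so this holds over any nontrivial commutative
    ring. *)
Lemma recurrence_subrXX (L : nat) : (p - q) * u L = p ^+ L.+1 - q ^+ L.+1.
Proof.
elim: L => [|L IHL]; first by rewrite u0 mulr1 !expr1.
rewrite recurrence_first_order mulrDr mulrCA IHL !exprS; ring.
Qed.

Lemma recurrence_double_root (L : nat) : p = q -> u L = L.+1%:R * p ^+ L.
Proof.
move=> pq; elim: L => [|L IHL]; first by rewrite u0 mulr1.
by rewrite recurrence_first_order IHL -pq -[L.+2]addn1 natrD !exprS; ring.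
Qed.

End SecondOrderRecurrence.

Lemma sqr_eq_4mul (g t k : nat) :
  ((g + t + k) ^ 2 = 4 * (g * t))%N <-> k = 0%N /\ g = t.
Proof.
split=> [h|[-> ->]]; last by rewrite addn0 -mulnn; nia.
have : (g%:Z - t%:Z) ^+ 2 + k%:Z * (2 * g%:Z + 2 * t%:Z + k%:Z) = 0.
  have hZ : (g%:Z + t%:Z + k%:Z) ^+ 2 = 4 * (g%:Z * t%:Z).
    by rewrite -!PoszD -PoszM -[4]/(4%N%:Z) -PoszM -h -mulnn PoszM expr2.
  transitivity ((g%:Z + t%:Z + k%:Z) ^+ 2 - 4 * (g%:Z * t%:Z)); first by ring.
  by rewrite hZ subrr.
(* Both summands are nonnegative, hence zero. If [2g + 2t + k] is the vanishing factor of the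
   second, then [k = 0] again. *)
move/eqP; rewrite paddr_eq0 ?sqr_ge0 ?mulr_ge0 //.
by rewrite sqrf_eq0 mulf_eq0 => /andP[/eqP gt] /orP[] /eqP; lia.
Qed.

Theorem theorem3p5 (R : rcfType) (X : finType) (T : X -> bool -> bool)
    (hT : forall x : X, [|| is_GEN (T x), is_PROP (T x) | is_KILL (T x)]) :
  let N := #|X| in
  let g := num_GEN T in
  let t := num_PROP T in
  let k := num_KILL T in
  let d := (g * t)%N in
  let a := num_cascade_free T in
  [/\ (* the recurrence, as an identity between integers *)
      forall L : nat, (2 <= L)%N ->
        (a L)%:Z = N%:Z * (a (L - 1)%N)%:Z - d%:Z * (a (L - 2)%N)%:Z,
      a 0%N = 1%N /\ a 1%N = N,
      (4 * d < N ^ 2)%N ->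
        let lambda1 : R := (N%:R + Num.sqrt (N%:R ^+ 2 - 4 * d%:R)) / 2 in
        let lambda2 : R := (N%:R - Num.sqrt (N%:R ^+ 2 - 4 * d%:R)) / 2 in
        forall L : nat,
          (a L)%:R =
            (lambda1 ^+ L.+1 - lambda2 ^+ L.+1) / (lambda1 - lambda2),
      (N ^ 2)%N = (4 * d)%N <->
        [/\ k = 0%N, g%:R = N%:R / 2 :> R & t%:R = N%:R / 2 :> R]
    & (N ^ 2)%N = (4 * d)%N ->
        forall L : nat, (a L)%:R = L.+1%:R * (N%:R / 2) ^+ L :> R].
Proof.
move=> N g t k d a.
have NE : N = (g + t + k)%N by exact: card_classes.
have aSS L : (a L.+2 + d * a L = N * a L.+1)%N by exact: num_cascade_freeSS.
have a0 : a 0%N = 1%N by exact: num_cascade_free0.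
have a1 : a 1%N = N by exact: num_cascade_free1.
(* By Vieta, any [p], [q] with sum [N] and product [d] are characteristic roots; both closed forms
   use this. *)
have aR (p q : R) : p + q = N%:R -> p * q = d%:R ->
    forall L, (a L.+2)%:R = (p + q) * (a L.+1)%:R - p * q * (a L)%:R :> R.
  by move=> -> -> L; rewrite -!natrM -aSS natrD addrK.
have deg : (N ^ 2 = 4 * d)%N <-> k = 0%N /\ g = t.
  by rewrite NE; exact: sqr_eq_4mul.
split.
- case=> [//|[//|L]] _; rewrite !subSS !subn0.
  by have := aSS L; lia.
- by [].
- move=> dN lambda1 lambda2 L.
  set D := N%:R ^+ 2 - 4 * d%:R in lambda1 lambda2 *.
  have D_gt0 : 0 < D by rewrite subr_gt0 -natrX -natrM ltr_nat.
  have sD : Num.sqrt D ^+ 2 = D by rewrite sqr_sqrtr // ltW.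
  have lB : lambda1 - lambda2 = Num.sqrt D.
    by rewrite /lambda1 /lambda2; field.
  have lD : lambda1 + lambda2 = N%:R by rewrite /lambda1 /lambda2; field.
  have lM : lambda1 * lambda2 = d%:R.
    (* A difference of squares, in which [sD] then replaces the squared root by the discriminant. *)
    have -> : lambda1 * lambda2 = (N%:R ^+ 2 - Num.sqrt D ^+ 2) / 4.
      by rewrite /lambda1 /lambda2; field.
    by rewrite sD /D; field.
  have lB0 : lambda1 - lambda2 != 0 by rewrite lB sqrtr_eq0 -ltNge.
  rewrite -(recurrence_subrXX _ (fun L => (a L)%:R)) ?a0 ?a1 //; last exact: aR.
  by rewrite mulrC mulKf.
- rewrite deg; split=> [[k0 gt]|[k0 gN tN]].
    have -> : N%:R = g%:R * 2 :> R by rewrite NE k0 gt -natrM; congr _%:R; lia.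
    by rewrite mulfK ?pnatr_eq0 // gt.
  (* Both sizes equal [N / 2] in [R], and naturals embed injectively there. *)
  by split=> //; apply/eqP; rewrite -(eqr_nat R) gN tN.
- move=> hN L; have [k0 gt] := deg.1 hN.
  have NR : N%:R / 2 + N%:R / 2 = N%:R :> R by field.
  apply: (recurrence_double_root _ (fun L => (a L)%:R) _ (N%:R / 2));
    rewrite ?a0 ?a1 //.
  apply: aR => //.
  (* The double root [N / 2] has product [N ^ 2 / 4], which is [d] by [hN]. *)
  have -> : N%:R / 2 * (N%:R / 2) = (N ^ 2)%:R / 4 :> R.
    by rewrite natrX; field.
  by rewrite hN natrM mulrC mulKf ?pnatr_eq0.
Qed.
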